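(* Let $k\ge 1$ be an integer. If $k\ge 17$ then the quartic form $q_k^{\mathbb{O}}$ is not a sum of squares. If $k\le 16$ then $q_k^{\mathbb{O}}$ is a sum of squares.
   Context: $\mathbb{O}$ denotes the octonions: the $8$-dimensional real normed division algebra with basis $e_0=1,e_1,\ldots,e_7$. For $u=\sum_{i=0}^7 a_ie_i$, the conjugate is $\overline{u}=a_0e_0-\sum_{i=1}^7 a_ie_i$ and the norm is $|u|=(\overline{u}u)^{1/2}=(\sum_{i=0}^7a_i^2)^{1/2}$. For $x,y\in\mathbb{O}^k$, put $\|x\|^2=\sum_{i=1}^k|x_i|^2$ and $(x,y)=\sum_{i=1}^k\overline{x_i}y_i\in\mathbb{O}$. Define $$q_k^{\mathbb{O}}(x,y)=\|x\|^2\|y\|^2-|(x,y)|^2+\tfrac14\left(\|x\|^2+\|y\|^2\right)^2,\qquad (x,y)\in\mathbb{O}^k\times\mathbb{O}^k\cong\mathbb{R}^{16k},$$ a quartic form in the $16k$ real coordinates of $(x,y)$. A form (homogeneous real polynomial) is a sum of squares if it is a finite sum of squares of real polynomials. *)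

(* Defs.v *)
From HB Require Import structures.
From mathcomp Require Import all_boot all_order all_algebra.
From mathcomp Require Import reals.
From mathcomp Require Import mpoly.
From mathcomp Require Import ring.

Set Implicit Arguments.
Unset Strict Implicit.
Unset Printing Implicit Defensive.

Import Order.TTheory GRing.Theory Num.Theory.
Local Open Scope ring_scope.

(* The oriented lines of the Fano plane for the convention
   e_i e_(i+1) = e_(i+3), indices 1..7 being read modulo 7: a triple (i, j, k)
   stands for e_i e_j = e_k, e_j e_k = e_i and e_k e_i = e_j. *)
Definition fano_lines : seq (nat * nat * nat) :=
  [:: (1, 2, 4); (2, 3, 5); (3, 4, 6); (4, 5, 7); (5, 6, 1); (6, 7, 2);
      (7, 1, 3)]%N.

Definition fano (i j k : nat) : bool :=
  [|| (i, j, k) \in fano_lines, (j, k, i) \in fano_lines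
    | (k, i, j) \in fano_lines].

(* Octonions with coordinates in a commutative ring A; the real octonions are
   the case A = R. The case of a polynomial ring A serves to turn formulas
   on octonions into polynomials in their real coordinates. *)
Notation oct A := 'rV[A]_8.

Section Octonions.
Variable A : comNzRingType.
Implicit Types u v : oct A.

(* The coefficient of e_k in the product e_i e_j. *)
Definition oct_coef (i j k : nat) : A :=
  if i == 0%N then (if j == k then 1 else 0)
  else if j == 0%N then (if i == k then 1 else 0)
  else if i == j then (if k == 0%N then -1 else 0)
  else if fano i j k then 1
  else if fano j i k then -1
  else 0.

Definition oct_mul u v : oct A :=
  \row_(k < 8) \sum_(i < 8) \sum_(j < 8) oct_coef i j k * (u 0 i * v 0 j).

Definition oct_conj u : oct A :=
  \row_(i < 8) (if i == 0 then u 0 i else - u 0 i).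

(* The square |u|^2 of the norm. *)
Definition oct_normsq u : A := \sum_(i < 8) u 0 i ^+ 2.

Definition oct_e (i : 'I_8) : oct A := delta_mx 0 i.

Variable k : nat.
Implicit Types x y : 'I_k -> oct A.

Definition octv_normsq x : A := \sum_(i < k) oct_normsq (x i).

Definition octv_dot x y : oct A := \sum_(i < k) oct_mul (oct_conj (x i)) (y i).

End Octonions.

Definition qO (R : fieldType) (A : comAlgType R) (k : nat)
    (x y : 'I_k -> oct A) : A :=
  octv_normsq x * octv_normsq y - oct_normsq (octv_dot x y)
  + 4^-1 *: (octv_normsq x + octv_normsq y) ^+ 2.

(* The 16 k real coordinates of (x, y) as variables: for i < k and a < 8, the
   variable of index lshift _ (mxvec_index i a) is the a-th coordinate of x_i,
   and the one of index rshift _ (mxvec_index i a) is the a-th coordinate of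
   y_i. *)
Definition xvars (R : realType) (k : nat) (i : 'I_k) :
    oct {mpoly R[k * 8 + k * 8]} :=
  \row_(a < 8) 'X_(lshift (k * 8) (mxvec_index i a)).

Definition yvars (R : realType) (k : nat) (i : 'I_k) :
    oct {mpoly R[k * 8 + k * 8]} :=
  \row_(a < 8) 'X_(rshift (k * 8) (mxvec_index i a)).

Definition qO_form (R : realType) (k : nat) : {mpoly R[k * 8 + k * 8]} :=
  qO (@xvars R k) (@yvars R k).

Definition is_sos (R : realType) (n : nat) (p : {mpoly R[n]}) : Prop :=
  exists s : seq {mpoly R[n]}, p = \sum_(f <- s) f ^+ 2.

(* By Hurwitz's theorem, the unit laws and the multiplicativity of the norm
   characterise the octonions among 8-dimensional real algebras. *)
Section OctonionFacts.
Variable A : comNzRingType.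
Implicit Types u v : oct A.

Let o8 (i : nat) (lt_i8 : (i < 8)%N) : 'I_8 := Ordinal lt_i8.

Lemma sum_ord8 (F : 'I_8 -> A) : \sum_(i < 8) F i =
  F (@o8 0 isT) + F (@o8 1 isT) + F (@o8 2 isT) + F (@o8 3 isT)
  + F (@o8 4 isT) + F (@o8 5 isT) + F (@o8 6 isT) + F (@o8 7 isT).
Proof.
rewrite !big_ord_recr big_ord0 /= add0r.
by do !congr (_ + _); congr F; apply/val_inj.
Qed.

Lemma oct_mulE u v (k : 'I_8) : oct_mul u v 0 k =
   \sum_(i < 8) \sum_(j < 8) oct_coef A i j k * (u 0 i * v 0 j).
Proof. by rewrite mxE. Qed.

Lemma oct_mul1l u : oct_mul (oct_e A 0) u = u.
Proof.
apply/rowP => k; rewrite mxE (bigD1 0) //= [X in _ + X]big1 ?addr0 => [|i i0].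
  rewrite (bigD1 k) //= big1 ?addr0 => [|j jk].
    by rewrite mxE !eqxx /oct_coef /= eqxx !mul1r.
  by rewrite /oct_coef /= (inj_eq val_inj) (negbTE jk) mul0r.
by rewrite big1 // => j _; rewrite mxE (negbTE i0) mul0r mulr0.
Qed.

Lemma oct_mul1r u : oct_mul u (oct_e A 0) = u.
Proof.
apply/rowP => k; rewrite mxE (bigD1 k) //= [X in _ + X]big1 ?addr0 => [|i ik].
  rewrite (bigD1 0) //= big1 ?addr0 => [|j j0].
    by rewrite mxE !eqxx mulr1 /oct_coef /= eqxx; case: eqP => [->|_]; rewrite mul1r.
  by rewrite mxE (negbTE j0) !mulr0.
rewrite big1 // => j _; rewrite mxE; have [->|_] /= := eqVneq j 0; last first.
  by rewrite !mulr0.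
rewrite /oct_coef /= (inj_eq val_inj) (negbTE ik) eq_sym.
case: (eqVneq (i : nat) 0%N) => [i0|_]; last by rewrite mul0r.
case: eqP => [k0|_]; last by rewrite mul0r.
by case/eqP: ik; apply/val_inj; exact: etrans i0 k0.
Qed.

Lemma oct_normsqM u v : oct_normsq (oct_mul u v) = oct_normsq u * oct_normsq v.
Proof.
rewrite /oct_normsq !sum_ord8 !oct_mulE !sum_ord8.
rewrite /oct_coef /=.
do 8?[move: (u 0 _) => ?]; do 8?[move: (v 0 _) => ?].
ring.
Qed.

Lemma oct_conjMl u : oct_mul (oct_conj u) u = oct_normsq u *: oct_e A 0.
Proof.
apply/rowP => k; rewrite oct_mulE /oct_normsq !sum_ord8 !mxE /=.
case: k => [[|[|[|[|[|[|[|[|//]]]]]]]] ?].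
all: rewrite /oct_coef /=.
all: ring.
Qed.

End OctonionFacts.

Section Evaluation.
Variables (R : realType) (k : nat).
Implicit Types x y : 'I_k -> oct R.

(* The point of R^(16 k) corresponding to (x, y) in O^k x O^k. *)
Definition qO_point x y : 'I_(k * 8 + k * 8) -> R :=
  row_mx (mxvec (\matrix_(i, a) x i 0 a)) (mxvec (\matrix_(i, a) y i 0 a)) 0.

Lemma meval_xvars x y i a : (@xvars R k i 0 a).@[qO_point x y] = x i 0 a.
Proof. by rewrite mxE mevalXU /qO_point row_mxEl mxvecE mxE. Qed.

Lemma meval_yvars x y i a : (@yvars R k i 0 a).@[qO_point x y] = y i 0 a.
Proof. by rewrite mxE mevalXU /qO_point row_mxEr mxvecE mxE. Qed.

Lemma meval_oct_coef n (v : 'I_n -> R) i j l :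
  (oct_coef {mpoly R[n]} i j l).@[v] = oct_coef R i j l.
Proof.
by rewrite /oct_coef; do !case: ifP => _; rewrite ?rmorphN ?rmorph1 ?rmorph0.
Qed.

Lemma meval_qO_form x y : (qO_form R k).@[qO_point x y] = qO (A := R^o) x y.
Proof.
have nx : (octv_normsq (@xvars R k)).@[qO_point x y] = octv_normsq x.
  rewrite rmorph_sum; apply: eq_bigr => i _; rewrite rmorph_sum /=.
  by apply: eq_bigr => a _; rewrite rmorphXn /= meval_xvars.
have ny : (octv_normsq (@yvars R k)).@[qO_point x y] = octv_normsq y.
  rewrite rmorph_sum; apply: eq_bigr => i _; rewrite rmorph_sum /=.
  by apply: eq_bigr => a _; rewrite rmorphXn /= meval_yvars.
have nd : (oct_normsq (octv_dot (@xvars R k) (@yvars R k))).@[qO_point x y] =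
    oct_normsq (octv_dot x y).
  rewrite rmorph_sum; apply: eq_bigr => c _; rewrite rmorphXn /=; congr (_ ^+ 2).
  rewrite /octv_dot !summxE rmorph_sum; apply: eq_bigr => i _ /=.
  rewrite !oct_mulE rmorph_sum; apply: eq_bigr => a _ /=.
  rewrite rmorph_sum; apply: eq_bigr => b _ /=.
  rewrite !rmorphM /= meval_oct_coef meval_yvars; congr (_ * (_ * _)).
  rewrite [in LHS]mxE [in RHS]mxE.
  by case: ifP => _; rewrite ?rmorphN /= meval_xvars.
rewrite /qO_form /qO mevalD mevalB mevalM mevalZ rmorphXn /= mevalD.
by rewrite nx ny nd.
Qed.

Lemma qO_form_homog : qO_form R k \is 4.-homog.
Proof.
have X1 i : ('X_i : {mpoly R[k * 8 + k * 8]}) \is 1.-homog.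
  by rewrite dhomogX; apply/eqP/mdeg1.
have x1 i a : @xvars R k i 0 a \is 1.-homog by rewrite mxE X1.
have y1 i a : @yvars R k i 0 a \is 1.-homog by rewrite mxE X1.
have nx : octv_normsq (@xvars R k) \is 2.-homog.
  apply: rpred_sum => i _; apply: rpred_sum => a _.
  exact: (@dhomogMn _ _ _ 1%N _ 2%N).
have ny : octv_normsq (@yvars R k) \is 2.-homog.
  apply: rpred_sum => i _; apply: rpred_sum => a _.
  exact: (@dhomogMn _ _ _ 1%N _ 2%N).
apply: rpredD; last first.
  have nxy := rpredD nx ny.
  exact: (dhomogZ _ (@dhomogMn _ _ _ 2%N _ 2%N nxy)).
apply: rpredB; first exact: (dhomogM nx ny).
apply: rpred_sum => c _; apply: (@dhomogMn _ _ _ 2%N _ 2%N).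
rewrite summxE; apply: rpred_sum => i _; rewrite oct_mulE.
apply: rpred_sum => a _; apply: rpred_sum => b _.
have h : oct_conj (@xvars R k i) 0 a * @yvars R k i 0 b \is 2.-homog.
  apply: (@dhomogM _ _ _ 1%N _ 1%N) => //; rewrite mxE.
  by case: ifP => _; rewrite ?rpredN.
rewrite /oct_coef; do !case: ifP => _;
  by rewrite ?mul1r ?mul0r ?mulN1r ?rpredN ?rpred0.
Qed.

End Evaluation.

(* Main.v *)
(* Let P_0, ..., P_8 be the Clifford system on R^16 = O x O with
   <P_0 z, z> = |x|^2 - |y|^2 and <P_(c+1) z, z> = 2 (conj(x) y)_c, and put
   Q_i = sum_m <P_i z_m, z_m> for z = (z_1, ..., z_k). Then
   4 q = 2 |z|^4 - sum_i Q_i^2.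

   The space of 16 x 16 matrices splits under Spin(9) into 1 + 9 + 126
   (symmetric) and 36 + 84 (skew). Summing over all pairs (m, n) the squared
   norms of the 84-component of z_m z_n^T gives, up to a positive factor,
   7.5 |z|^4 - 3.5 sum_i Q_i^2 - 4 sum_i sum_(m,n) <P_i z_m, z_n>^2. The matrix
   (<P_i z_m, z_n>)_(m,n) is k x k of trace Q_i, so its squared norm exceeds
   Q_i^2 / 16 by a sum of squares if k <= 16. Adding up, 15 q is then a sum of
   squares.

   Conversely, the apolar pairing with
   5 |z|^4 + sum_i Q_i^2 + 4 sum_(m,n) <z_m, z_n>^2 is nonnegative on squares of
   quadratic forms, since it vanishes on exactly the isotypic components used
   above, and its value at q is a positive multiple of - k (k - 16). *)
Require Import Defs.
From mathcomp Require Import all_boot all_order all_algebra.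
From mathcomp Require Import reals.
From mathcomp Require Import mpoly.
From mathcomp Require Import ring lra.
Set Implicit Arguments.
Unset Strict Implicit.
Unset Printing Implicit Defensive.
Import Order.TTheory GRing.Theory Num.Theory.
Local Open Scope ring_scope.

(** * Structure constants of the octonions *)

(* The coefficient of e_c in conj(e_a) e_b. *)
Definition lcoef (A : comNzRingType) (c a b : nat) : A :=
  if a == 0%N then oct_coef A a b c else - oct_coef A a b c.

(* The coefficients are signs or zero, so identities between them are checked
   over int, by computation, and transferred to any commutative ring. *)
Lemma lcoef_int (A : comNzRingType) c a b :
  lcoef A c a b = (lcoef int c a b)%:~R.
Proof.
have oct_coef_int i j l : oct_coef A i j l = (oct_coef int i j l)%:~R.
  by rewrite /oct_coef !(fun_if (fun x : int => x%:~R : A)) rmorphN rmorph1 rmorph0.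
by rewrite /lcoef; case: (a == 0)%N; rewrite ?mulrNz -oct_coef_int.
Qed.

(** Big operators are locked against computation, so the sums to be evaluated by [vm_compute] are
    written as folds. *)
Definition sum_below8 (F : nat -> int) : int :=
  foldr (fun i s => F i + s) 0 (iota 0%N 8%N).

Lemma sum_below8E (F : nat -> int) : sum_below8 F = \sum_(i < 8) F i.
Proof. by rewrite -(big_mkord xpredT F) unlock. Qed.

(* The inner product of conj(e_a) e_b and conj(e_a') e_b'. *)
Definition gcoef (A : comNzRingType) (a b a' b' : nat) : A :=
  \sum_(c < 8) lcoef A c a b * lcoef A c a' b'.

Definition gcoef_int (a b a' b' : nat) : int :=
  sum_below8 (fun c => lcoef int c a b * lcoef int c a' b').

Lemma gcoefE (A : comNzRingType) a b a' b' :
  gcoef A a b a' b' = (gcoef_int a b a' b')%:~R.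
Proof.
rewrite /gcoef_int sum_below8E rmorph_sum; apply: eq_bigr => c _.
by rewrite rmorphM /= -!lcoef_int.
Qed.

Definition pairs8 : seq (nat * nat) := allpairs pair (iota 0%N 8%N) (iota 0%N 8%N).

Definition sum_pairs8 (F : nat * nat -> int) : int :=
  foldr (fun p s => F p + s) 0 pairs8.

Lemma sum_pairs8E F : sum_pairs8 F = \sum_(a < 8) \sum_(b < 8) F (a : nat, b : nat).
Proof.
have iota8 G : \sum_(i <- iota 0%N 8%N) G i = \sum_(i < 8) G i :> int.
  by rewrite -(big_mkord xpredT).
transitivity (\sum_(p <- pairs8) F p); first by rewrite unlock.
by rewrite big_allpairs iota8; apply: eq_bigr => a _; rewrite iota8.
Qed.

Lemma mem_pairs8 (a b : 'I_8) : (a : nat, b : nat) \in pairs8.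
Proof. by apply: allpairs_f; rewrite mem_iota /= ltn_ord. Qed.

(** Polarisation, in v, of <conj(u) v, conj(u') v> = <u, u'> |v|^2, itself a polarised form of the
    composition law. *)
Lemma gcoef_int_sym : all (fun p => all (fun q =>
    gcoef_int p.1 p.2 q.1 q.2 + gcoef_int p.1 q.2 q.1 p.2
      == (p == q)%:Z *+ 2) pairs8) pairs8.
Proof. by vm_compute. Qed.

Lemma gcoef_sym (A : comNzRingType) (a b a' b' : 'I_8) :
  gcoef A a b a' b' + gcoef A a b' a' b = ((a == a') && (b == b'))%:R *+ 2.
Proof.
have /allP/(_ _ (mem_pairs8 a b)) := gcoef_int_sym.
move=> /allP/(_ _ (mem_pairs8 a' b'))/eqP /= e.
by rewrite !gcoefE -rmorphD /= e rmorphMn /= xpair_eqE !(inj_eq val_inj).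
Qed.

(** For q = (b, b'), these are the entries of the image of E_bb' - E_b'b under the map [Theta]
    defined below. *)
Definition skew_row (q : nat * nat) : seq int :=
  [seq gcoef_int p.1 q.1 p.2 q.2 - gcoef_int p.1 q.2 p.2 q.1 | p <- pairs8].

(** This Gram matrix is 16 times that of the matrices E_bb' - E_b'b, which is why [Theta] is 4 times
    an isometry on skew matrices. The [let] has each row tabulated only once. *)
Lemma skew_row_orthogonal :
  let rows := [seq (q, skew_row q) | q <- pairs8] in
  all (fun s => all (fun t =>
    foldr (fun u z => u.1 * u.2 + z) 0 (zip s.2 t.2)
      == ((s.1 == t.1)%:Z - (s.1 == (t.1.2, t.1.1))%:Z) *+ 32) rows) rows.
Proof. by vm_compute. Qed.

Lemma gcoef_skew (A : comNzRingType) (b b' d d' : 'I_8) :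
  \sum_(a < 8) \sum_(a' < 8) (gcoef A a b a' b' - gcoef A a b' a' b) *
    (gcoef A a d a' d' - gcoef A a d' a' d) =
  (((b == d) && (b' == d'))%:R - ((b == d') && (b' == d))%:R) *+ 32.
Proof.
have /allP := skew_row_orthogonal.
move=> /(_ _ (map_f _ (mem_pairs8 b b')))/allP.
move=> /(_ _ (map_f _ (mem_pairs8 d d')))/eqP.
rewrite -[RHS]/((_ *+ 32)) [_.1]/= !xpair_eqE !(inj_eq val_inj) => e.
transitivity ((sum_pairs8 (fun p =>
  (gcoef_int p.1 b p.2 b' - gcoef_int p.1 b' p.2 b) *
  (gcoef_int p.1 d p.2 d' - gcoef_int p.1 d' p.2 d)))%:~R : A).
  rewrite sum_pairs8E rmorph_sum; apply: eq_bigr => a _.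
  rewrite rmorph_sum; apply: eq_bigr => a' _.
  by rewrite rmorphM !rmorphB /= -!gcoefE.
rewrite (_ : sum_pairs8 _ = foldr (fun u z => u.1 * u.2 + z) 0
  (zip (skew_row (b : nat, b' : nat)) (skew_row (d : nat, d' : nat)))); last first.
  by rewrite zip_map foldr_map.
by rewrite e rmorphMn rmorphB.
Qed.

(** A product of basis elements is plus or minus a basis element, so the arrays for distinct c have
    disjoint supports, with 8 signs each. *)
Lemma lcoef_orthogonal_int : all (fun c => all (fun d =>
    sum_pairs8 (fun p => lcoef int c p.1 p.2 * lcoef int d p.1 p.2)
      == (c == d)%:Z *+ 8) (iota 0%N 8%N)) (iota 0%N 8%N).
Proof. by vm_compute. Qed.

Lemma lcoef_orthogonal (A : comNzRingType) (c d : 'I_8) :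
  \sum_(a < 8) \sum_(b < 8) lcoef A c a b * lcoef A d a b = (c == d)%:R *+ 8.
Proof.
have mem8 (i : 'I_8) : (i : nat) \in iota 0%N 8%N by rewrite mem_iota /= ltn_ord.
have /allP/(_ _ (mem8 c))/allP/(_ _ (mem8 d))/eqP := lcoef_orthogonal_int.
rewrite sum_pairs8E (inj_eq val_inj) => /(congr1 (fun z : int => z%:~R : A)).
rewrite rmorphMn rmorph_sum => <-; apply: eq_bigr => a _.
by rewrite rmorph_sum; apply: eq_bigr => b _; rewrite rmorphM /= -!lcoef_int.
Qed.

(** * Octonion multiplication as matrices *)

Section OctonionMatrices.
Variable A : comNzRingType.
Implicit Types (X Y : 'M[A]_8) (u v : oct A).

Definition ip X Y : A := \sum_a \sum_b X a b * Y a b.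

Lemma ipC X Y : ip X Y = ip Y X.
Proof. by apply: eq_bigr => a _; apply: eq_bigr => b _; rewrite mulrC. Qed.

Lemma ipDl X Y Z : ip (X + Y) Z = ip X Z + ip Y Z.
Proof.
rewrite -big_split; apply: eq_bigr => a _; rewrite -big_split.
by apply: eq_bigr => b _; rewrite mxE mulrDl.
Qed.

Lemma ipZl t X Y : ip (t *: X) Y = t * ip X Y.
Proof.
rewrite mulr_sumr; apply: eq_bigr => a _; rewrite mulr_sumr.
by apply: eq_bigr => b _; rewrite mxE mulrA.
Qed.

Lemma ipNl X Y : ip (- X) Y = - ip X Y.
Proof. by rewrite -scaleN1r ipZl mulN1r. Qed.

Lemma ipDr X Y Z : ip X (Y + Z) = ip X Y + ip X Z.
Proof. by rewrite ipC ipDl !(ipC _ X). Qed.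

Lemma ipZr t X Y : ip X (t *: Y) = t * ip X Y.
Proof. by rewrite ipC ipZl ipC. Qed.

Lemma ipNr X Y : ip X (- Y) = - ip X Y.
Proof. by rewrite ipC ipNl ipC. Qed.

Definition ipE := (ipDl, ipDr, ipZl, ipZr, ipNl, ipNr).

Lemma ip_sumr (I : finType) X (F : I -> 'M[A]_8) :
  ip X (\sum_i F i) = \sum_i ip X (F i).
Proof.
elim/big_rec2: _ => [|i y Z _ <-]; last by rewrite ipDr.
by rewrite -(scale0r 0) ipZr mul0r.
Qed.

Lemma ip_tr X Y : ip X^T Y^T = ip X Y.
Proof.
rewrite /ip exchange_big; apply: eq_bigr => a _; apply: eq_bigr => b _.
by rewrite !mxE.
Qed.

Lemma ip_scalar X t : ip X t%:M = t * \tr X.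
Proof.
rewrite /ip mulr_sumr; apply: eq_bigr => a _.
rewrite (bigD1 a) //= mxE eqxx mulr1n mulrC big1 ?addr0 // => b ba.
by rewrite mxE eq_sym (negbTE ba) mulr0.
Qed.

(** As a bilinear form, [Lmx c] is the c-th coordinate of conj(u) v. *)
Definition Lmx (c : 'I_8) : 'M[A]_8 := \matrix_(a, b) lcoef A c a b.

Lemma ip_Lmx c d : ip (Lmx c) (Lmx d) = (c == d)%:R *+ 8.
Proof.
rewrite -lcoef_orthogonal; apply: eq_bigr => a _.
by apply: eq_bigr => b _; rewrite !mxE.
Qed.

(** Over the reals this is 8 times the orthogonal projection onto the span of the [Lmx c]; the
    factor 8 avoids division in [A]. *)
Definition Lsum X : 'M[A]_8 := \sum_c ip (Lmx c) X *: Lmx c.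

Lemma ip_Lsum X Y : ip X (Lsum Y) = \sum_c ip (Lmx c) X * ip (Lmx c) Y.
Proof.
rewrite ip_sumr; apply: eq_bigr => c _.
by rewrite ipZr mulrC (ipC X).
Qed.

Lemma ip_Lmx_Lsum c X : ip (Lmx c) (Lsum X) = 8 * ip (Lmx c) X.
Proof.
rewrite ip_Lsum (bigD1 c) //= ip_Lmx eqxx big1 ?addr0 // => d dc.
by rewrite ip_Lmx (negbTE dc) mul0rn mul0r.
Qed.

Lemma ip_sub_Lsum X : ip (8 *: X - Lsum X) (8 *: X - Lsum X) =
  64 * ip X X - 8 * \sum_c ip (Lmx c) X ^+ 2.
Proof.
have e1 : ip X (Lsum X) = \sum_c ip (Lmx c) X ^+ 2 by rewrite ip_Lsum.
have e2 : ip (Lsum X) (Lsum X) = 8 * \sum_c ip (Lmx c) X ^+ 2.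
  rewrite ip_Lsum mulr_sumr; apply: eq_bigr => c _.
  by rewrite ip_Lmx_Lsum -mulrA.
rewrite !ipE (ipC (Lsum X) X) e1 e2.
ring.
Qed.

(* Theta X = sum_c L_c X L_c^T. It intertwines the two half-spin actions; on
   symmetric matrices it only sees the trace, on skew ones it is 4 times an
   isometry. *)
Definition Theta X : 'M[A]_8 :=
  \matrix_(a, a') \sum_(b < 8) \sum_(b' < 8) gcoef A a b a' b' * X b b'.

Lemma ThetaD X Y : Theta (X + Y) = Theta X + Theta Y.
Proof.
apply/matrixP => a a'; rewrite !mxE -big_split; apply: eq_bigr => b _.
by rewrite -big_split; apply: eq_bigr => b' _; rewrite mxE mulrDr.
Qed.

Lemma ThetaN X : Theta (- X) = - Theta X.
Proof.
apply/matrixP => a a'; rewrite !mxE -sumrN; apply: eq_bigr => b _.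
by rewrite -sumrN; apply: eq_bigr => b' _; rewrite mxE mulrN.
Qed.

Lemma gcoefC a b a' b' : gcoef A a b a' b' = gcoef A a' b' a b.
Proof. by apply: eq_bigr => c _; rewrite mulrC. Qed.

Lemma Theta_tr X : Theta X^T = (Theta X)^T.
Proof.
apply/matrixP => a a'; rewrite !mxE exchange_big; apply: eq_bigr => b _.
by apply: eq_bigr => b' _; rewrite mxE gcoefC.
Qed.

Lemma Theta_sym X : Theta (X + X^T) = (\tr X *+ 2)%:M.
Proof.
apply/matrixP => a a'; rewrite ThetaD Theta_tr !mxE -big_split /=.
transitivity (\sum_(b < 8) \sum_(b' < 8) ((a == a') && (b == b'))%:R *+ 2 * X b b').
  apply: eq_bigr => b _; rewrite -big_split; apply: eq_bigr => b' _.
  by rewrite /= -mulrDl (gcoefC a') gcoef_sym.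
have [_|_] /= := eqVneq a a'; last first.
  by rewrite big1 // => b _; rewrite big1 // => b' _; rewrite mul0rn mul0r.
rewrite -sumrMnl; apply: eq_bigr => b _.
rewrite (bigD1 b) //= eqxx big1 ?addr0 => [|b' bb']; first by rewrite mulr_natl.
by rewrite eq_sym (negbTE bb') mul0rn mul0r.
Qed.

(** Expanding in the entries of X contracts X twice with the Gram matrix of [gcoef_skew]. *)
Lemma Theta_skew X :
  ip (Theta (X - X^T)) (Theta (X - X^T)) = 16 * ip (X - X^T) (X - X^T).
Proof.
pose h (a a' : 'I_8) (p : 'I_8 * 'I_8) : A :=
  gcoef A a p.1 a' p.2 - gcoef A a p.2 a' p.1.
have ThE a a' : Theta (X - X^T) a a' = \sum_p h a a' p * X p.1 p.2.
  rewrite ThetaD ThetaN Theta_tr !mxE.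
  rewrite -(pair_bigA _ (fun b b' => h a a' (b, b') * X b b')) /=.
  rewrite -sumrB; apply: eq_bigr => b _; rewrite -sumrB.
  by apply: eq_bigr => b' _; rewrite /= -mulrBl (gcoefC a').
transitivity (\sum_p \sum_q X p.1 p.2 * X q.1 q.2 *
    \sum_a \sum_a' h a a' p * h a a' q).
  rewrite /ip; under eq_bigr do under eq_bigr do rewrite !ThE big_distrlr.
  rewrite pair_bigA exchange_big /=; apply: eq_bigr => p _.
  rewrite exchange_big /=; apply: eq_bigr => q _.
  rewrite pair_bigA mulr_sumr; apply: eq_bigr => -[a a'] _ /=; ring.
(* Here |X - X^T|^2 = 2 (|X|^2 - <X, X^T>), and 32 = 16 * 2. *)
transitivity ((ip X X - ip X X^T) *+ 32); last first.
  rewrite !ipE (ipC X^T X) ip_tr; ring.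
rewrite -sumrB -sumrMnl -(pair_bigA _ (fun b b' => \sum_q X b b' * X q.1 q.2 *
    \sum_a \sum_a' h a a' (b, b') * h a a' q)) /=.
apply: eq_bigr => b _; rewrite -sumrB -sumrMnl; apply: eq_bigr => b' _.
rewrite (eq_bigr (fun q => X b b' * (X q.1 q.2 *+ 32) * (q == (b, b'))%:R -
   X b b' * (X q.1 q.2 *+ 32) * (q == (b', b))%:R)); last first.
  move=> [d d'] _; rewrite /h gcoef_skew /= !xpair_eqE (eq_sym d b) (eq_sym d' b').
  rewrite (eq_sym d b') (eq_sym d' b) (andbC (b' == d)).
  ring.
rewrite sumrB (bigD1 (b, b')) //= eqxx big1 => [|q /negbTE ->]; last by rewrite mulr0.
rewrite (bigD1 (b', b)) //= eqxx big1 => [|q /negbTE ->]; last by rewrite mulr0.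
rewrite mxE /=; ring.
Qed.

Lemma ip_Theta_skew X Y :
  ip (4 *: X - Theta (Y - Y^T)) (4 *: X - Theta (Y - Y^T)) =
  16 * ip X X - 8 * ip X (Theta (Y - Y^T)) + 16 * ip (Y - Y^T) (Y - Y^T).
Proof.
rewrite -(Theta_skew Y) !ipE (ipC (Theta _) X); ring.
Qed.

End OctonionMatrices.

(** * Matrix inequalities behind the nonnegativity of the functional *)

Section Positivity.
Variable R : realFieldType.
Implicit Types X Y : 'M[R]_8.

Lemma ip_ge0 X : 0 <= ip X X.
Proof. by do 2!apply: sumr_ge0 => ? _; rewrite -expr2 sqr_ge0. Qed.

Lemma ip_sym_ge_tr X : (\tr X) ^+ 2 <= 2 * ip (X + X^T) (X + X^T).
Proof.
(* [T] is the projection of [S] onto scalar matrices, since tr S / 8 = tr X / 4; this is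
   Cauchy-Schwarz against the identity. *)
pose S := X + X^T; pose T : 'M[R]_8 := (\tr X / 4)%:M.
have ip_sqrB U V : ip (U - V) (U - V) = ip U U - 2 * ip U V + ip V V :> R.
  rewrite !ipE (ipC V U); ring.
have := ip_ge0 (S - T).
rewrite ip_sqrB !ip_scalar mxtraceD mxtrace_tr mxtrace_scalar -mulr_natl; lra.
Qed.

(** Symmetric and skew parts separate. The symmetric parts contribute at least 2 (tr X + tr Y)^2 by
    [ip_sym_ge_tr], besides the given trace square; on the skew parts [Theta] is 4 times an
    isometry, so its cross term is absorbed by the two norms. *)
Lemma ip_Theta_ge0 X Y :
  0 <= 12 * ip X X + 12 * ip Y Y + 4 * (\tr X + \tr Y) ^+ 2
       + 4 * ip X X^T + 4 * ip Y Y^T + 4 * ip X (Theta Y).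
Proof.
have sum_sqr (Z : 'M[R]_8) : 12 * ip Z Z + 4 * ip Z Z^T =
    4 * ip (Z + Z^T) (Z + Z^T) + 2 * ip (Z - Z^T) (Z - Z^T).
  rewrite !ipE !(ipC Z^T Z) !ip_tr; ring.
set V := Theta (Y - Y^T).
have ThY : 4 * ip X (Theta Y) = 4 * (\tr X * \tr Y) + ip (X - X^T) V.
  have eV : ip X^T V = - ip X V.
    by rewrite -ip_tr trmxK -Theta_tr linearB /= trmxK -ipNr -ThetaN opprB.
  have := Theta_sym Y; rewrite ThetaD => /(congr1 (ip X)).
  rewrite ip_scalar ipDl ipNl eV /V ThetaD ThetaN !ipE; lra.
(* The sign makes the cross term + 8 <X - X^T, V>; the expansion is 8 times the skew
   contribution. *)
have := ip_ge0 (4 *: (- (X - X^T)) - V).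
rewrite ip_Theta_skew -/V !(ipNl (X - X^T)) (ipNr (X - X^T)) => h.
have := sqr_ge0 (\tr X + \tr Y).
have := ip_sym_ge_tr X; have := ip_sym_ge_tr Y.
have := sum_sqr X; have := sum_sqr Y.
lra.
Qed.

(** With - 4 s t = (s - t)^2 - (s + t)^2 in each coordinate c, what remains is Bessel's inequality
    for X + Y and the orthogonal [Lmx c]. *)
Lemma ip_Lmx_ge0 X Y :
  0 <= 8 * ip X X + 8 * ip Y Y + 16 * ip X Y
       - 4 * \sum_c ip (Lmx R c) X * ip (Lmx R c) Y.
Proof.
have := ip_ge0 (8 *: (X + Y) - Lsum (X + Y)); rewrite ip_sub_Lsum => h.
have : 0 <= \sum_c (ip (Lmx R c) X - ip (Lmx R c) Y) ^+ 2.
  by apply: sumr_ge0 => c _; exact: sqr_ge0.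
have -> : \sum_c (ip (Lmx R c) X - ip (Lmx R c) Y) ^+ 2 =
    \sum_c ip (Lmx R c) (X + Y) ^+ 2 - 4 * \sum_c ip (Lmx R c) X * ip (Lmx R c) Y.
  rewrite mulr_sumr -sumrB; apply: eq_bigr => c _; rewrite ipDr; ring.
move: h; rewrite !ipE (ipC Y X); lra.
Qed.

End Positivity.

(** * The certificate for k <= 16 *)

Section PairIdentity.
Variable A : comNzRingType.
Implicit Types u v x y : oct A.

Definition outer u v : 'M[A]_8 := \matrix_(a, b) (u 0 a * v 0 b).
Definition dot u v : A := \sum_a u 0 a * v 0 a.
Definition conj_mul u v : oct A := oct_mul (oct_conj u) v.

Lemma dotC u v : dot u v = dot v u.
Proof. by apply: eq_bigr => a _; rewrite mulrC. Qed.

Lemma dotuu u : dot u u = oct_normsq u.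
Proof. by apply: eq_bigr. Qed.

Lemma outer_tr u v : (outer u v)^T = outer v u.
Proof. by apply/matrixP => a b; rewrite !mxE mulrC. Qed.

Lemma mxtrace_outer u v : \tr (outer u v) = dot u v.
Proof. by apply: eq_bigr => a _; rewrite mxE. Qed.

Lemma ip_outer u v u' v' :
  ip (outer u v) (outer u' v') = dot u u' * dot v v'.
Proof.
rewrite big_distrlr; apply: eq_bigr => a _; apply: eq_bigr => b _.
by rewrite !mxE mulrACA.
Qed.

Lemma conj_mulE u v c : conj_mul u v 0 c =
  \sum_(a < 8) \sum_(b < 8) lcoef A c a b * (u 0 a * v 0 b).
Proof.
rewrite oct_mulE; apply: eq_bigr => a _; apply: eq_bigr => b _.
rewrite [oct_conj u 0 a]mxE /lcoef -[a == 0]/(val a == 0%N).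
by case: eqP => // _; rewrite !mulNr mulrN.
Qed.

Lemma ip_Lmx_outer u v c : ip (Lmx A c) (outer u v) = conj_mul u v 0 c.
Proof.
by rewrite conj_mulE; apply: eq_bigr => a _; apply: eq_bigr => b _; rewrite !mxE.
Qed.

Lemma ip_Theta_outer u u' v v' :
  ip (outer u u') (Theta (outer v v')) = dot (conj_mul u v) (conj_mul u' v').
Proof.
rewrite /dot.
under [RHS]eq_bigr do rewrite !conj_mulE big_distrlr.
rewrite [RHS]exchange_big; apply: eq_bigr => a _.
transitivity (\sum_(c < 8) \sum_(a' < 8) \sum_(b < 8) \sum_(b' < 8)
  lcoef A c a b * lcoef A c a' b' * (u 0 a * u' 0 a' * (v 0 b * v' 0 b'))).
  rewrite exchange_big; apply: eq_bigr => a' _.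
  rewrite [RHS]exchange_big !mxE mulr_sumr; apply: eq_bigr => b _.
  rewrite [RHS]exchange_big mulr_sumr; apply: eq_bigr => b' _.
  by rewrite -mulr_suml !mxE mulrCA.
apply: eq_bigr => c _; apply: eq_bigr => a' _.
rewrite big_distrlr; apply: eq_bigr => b _; apply: eq_bigr => b' _ /=.
by ring.
Qed.

Lemma conj_mul_normsq u v :
  oct_normsq (conj_mul u v) = oct_normsq u * oct_normsq v.
Proof.
rewrite oct_normsqM; congr (_ * _); apply: eq_bigr => a _.
by rewrite mxE; case: ifP; rewrite ?sqrrN.
Qed.

(** The polarised composition law, read off from [Theta_sym] on rank one matrices. *)
Lemma dot_conj_mul x y x' y' :
  dot (conj_mul x y) (conj_mul x' y') + dot (conj_mul x y') (conj_mul x' y) =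
  dot x x' * dot y y' *+ 2.
Proof.
rewrite -!ip_Theta_outer -(outer_tr y) -ipDr -ThetaD Theta_sym ip_scalar.
by rewrite !mxtrace_outer mulrC mulrnAr.
Qed.

(** The case of one pair z = (x, y), z' = (x', y'): the first two terms are a multiple of the
    squared norm of the 84-component of z z'^T, the factor 32 multiplies sum_i <P_i z, z'>^2, and
    the factor 28 multiplies sum_i <P_i z, z> <P_i z', z'>. *)
Lemma pair_identity x y x' y' :
  let B := outer x y' - outer x' y in
  let X := outer x x' - outer x' x in
  let V := Theta (outer y y' - (outer y y')^T) in
  ip (8 *: B - Lsum B) (8 *: B - Lsum B) + ip (4 *: X - V) (4 *: X - V)
  + 32 * ((dot x x' - dot y y') ^+ 2
          + \sum_c (conj_mul x y' 0 c + conj_mul x' y 0 c) ^+ 2) =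
  60 * (oct_normsq x + oct_normsq y) * (oct_normsq x' + oct_normsq y')
  - 28 * ((oct_normsq x - oct_normsq y) * (oct_normsq x' - oct_normsq y')
          + 4 * dot (conj_mul x y) (conj_mul x' y')).
Proof.
rewrite /= ip_sub_Lsum ip_Theta_skew.
set P := dot (conj_mul x y) _; set Q := dot (conj_mul x y') (conj_mul x' y).
have PQ : P + Q = dot x x' * dot y y' *+ 2 by exact: dot_conj_mul.
pose Nxy' := oct_normsq (conj_mul x y').
pose Nx'y := oct_normsq (conj_mul x' y).
have -> : \sum_c (conj_mul x y' 0 c + conj_mul x' y 0 c) ^+ 2 =
    Nxy' + Nx'y + Q *+ 2.
  rewrite -sumrMnl -!big_split; apply: eq_bigr => c _ /=; ring.
have -> : \sum_c ip (Lmx A c) (outer x y' - outer x' y) ^+ 2 =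
    Nxy' + Nx'y - Q *+ 2.
  rewrite -sumrMnl -big_split -sumrB; apply: eq_bigr => c _ /=.
  rewrite ipDr ipNr !ip_Lmx_outer; ring.
rewrite ThetaD ThetaN outer_tr !ipE !ip_Theta_outer !ip_outer.
rewrite -/P -/Q (dotC (conj_mul x' y)) (dotC (conj_mul x' y')) -/P -/Q.
rewrite !dotuu /Nxy' /Nx'y !conj_mul_normsq (dotC x' x) (dotC y' y).
(* Once the norms of products are factored, [PQ] is the only relation needed between the remaining
   scalars. *)
rewrite (_ : P = dot x x' * dot y y' *+ 2 - Q); last by rewrite -PQ addrK.
by ring.
Qed.

(** Subtracting t / 16 rather than t / k on the diagonal keeps the coefficients independent of k:
    256 |M|^2 - 16 t^2 is a sum of squares plus (16 - k) t^2. *)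
Lemma trace_identity k (M : 'I_k -> 'I_k -> A) t : \sum_i M i i = t ->
  \sum_i \sum_j (16 * M i j - (i == j)%:R * t) ^+ 2 =
  256 * (\sum_i \sum_j M i j ^+ 2) - 32 * t ^+ 2 + k%:R * t ^+ 2.
Proof.
move=> trM.
transitivity (\sum_i (256 * (\sum_j M i j ^+ 2) - 32 * t * M i i + t ^+ 2)).
  apply: eq_bigr => i _; rewrite (bigD1 i) //= [in RHS](bigD1 i) //= eqxx.
  rewrite (eq_bigr (fun j => 256 * M i j ^+ 2)) => [|j]; last first.
    by rewrite eq_sym => /negbTE ->; rewrite mul0r; ring.
  by rewrite -mulr_sumr mul1r; move: (\sum_(j < k | _) _) => z; ring.
rewrite big_split sumrB -!mulr_sumr trM sumr_const card_ord.
by rewrite -[t *+ k]mulr_natl /=; ring.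
Qed.

Variables (k : nat) (x y : 'I_k -> oct A).

Lemma octv_dotE c : octv_dot x y 0 c = \sum_i conj_mul (x i) (y i) 0 c.
Proof. by rewrite summxE. Qed.

Let B i j := outer (x i) (y j) - outer (x j) (y i).
Let V i j := 4 *: (outer (x i) (x j) - outer (x j) (x i))
             - Theta (outer (y i) (y j) - (outer (y i) (y j))^T).
Let W i j := ip (8 *: B i j - Lsum (B i j)) (8 *: B i j - Lsum (B i j))
             + ip (V i j) (V i j).
(** [P] and [Q c] are the k x k matrices <P_0 z_i, z_j> and <P_(c+1) z_i, z_j> of the Clifford
    system. *)
Let P i j := dot (x i) (x j) - dot (y i) (y j).
Let Q c i j := conj_mul (x i) (y j) 0 c + conj_mul (x j) (y i) 0 c.

Lemma sum_pair_identity :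
  \sum_i \sum_j W i j
  + 32 * (\sum_i \sum_j P i j ^+ 2 + \sum_c \sum_i \sum_j Q c i j ^+ 2) =
  60 * (octv_normsq x + octv_normsq y) ^+ 2
  - 28 * ((octv_normsq x - octv_normsq y) ^+ 2
          + 4 * oct_normsq (octv_dot x y)).
Proof.
have -> : oct_normsq (octv_dot x y) =
    \sum_i \sum_j dot (conj_mul (x i) (y i)) (conj_mul (x j) (y j)).
  under [RHS]eq_bigr do rewrite exchange_big.
  rewrite [RHS]exchange_big; apply: eq_bigr => c _.
  by rewrite octv_dotE expr2 big_distrlr.
have -> : \sum_c \sum_i \sum_j Q c i j ^+ 2 = \sum_i \sum_j \sum_c Q c i j ^+ 2.
  by rewrite exchange_big; apply: eq_bigr => i _; rewrite exchange_big.
have sumD (F G : 'I_k -> 'I_k -> A) : \sum_i \sum_j F i j + \sum_i \sum_j G i j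
    = \sum_i \sum_j (F i j + G i j).
  by rewrite -big_split; apply: eq_bigr => i _; rewrite big_split.
have sumZ t (F : 'I_k -> 'I_k -> A) : t * (\sum_i \sum_j F i j)
    = \sum_i \sum_j t * F i j.
  by rewrite mulr_sumr; apply: eq_bigr => i _; rewrite mulr_sumr.
have sqr_sum (F : 'I_k -> A) : (\sum_i F i) ^+ 2 = \sum_i \sum_j F i * F j.
  by rewrite expr2 big_distrlr.
have -> : octv_normsq x + octv_normsq y =
    \sum_i (oct_normsq (x i) + oct_normsq (y i)) by rewrite -big_split.
rewrite -sumrB !sqr_sum !(sumZ, sumD) -sumrN.
rewrite -big_split; apply: eq_bigr => i _; rewrite -sumrN -big_split.
apply: eq_bigr => j _ /=.
by have /= -> := pair_identity (x i) (y i) (x j) (y j); rewrite mulrA.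
Qed.

(* 64 times the certificate of 15 q, to clear denominators. *)
Lemma sos_identity (k16 : (k <= 16)%N) :
  960 * (octv_normsq x * octv_normsq y - oct_normsq (octv_dot x y))
  + 240 * (octv_normsq x + octv_normsq y) ^+ 2 =
  (\sum_i \sum_j W i j) *+ 8
  + \sum_i \sum_j
      (16 * P i j - (i == j)%:R * (octv_normsq x - octv_normsq y)) ^+ 2
  + \sum_c \sum_i \sum_j
      (16 * Q c i j - (i == j)%:R * (2 * octv_dot x y 0 c)) ^+ 2
  + ((octv_normsq x - octv_normsq y) ^+ 2
     + \sum_c (2 * octv_dot x y 0 c) ^+ 2) *+ (16 - k).
Proof.
rewrite trace_identity; last by under eq_bigr do rewrite /P !dotuu; rewrite sumrB.
rewrite (eq_bigr (fun c => 256 * (\sum_i \sum_j Q c i j ^+ 2)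
    - 32 * (2 * octv_dot x y 0 c) ^+ 2
    + k%:R * (2 * octv_dot x y 0 c) ^+ 2)); last first.
  move=> c _; apply: trace_identity.
  by rewrite octv_dotE mulr_sumr; apply: eq_bigr => i _; rewrite /Q; ring.
rewrite big_split sumrB -!mulr_sumr /=.
have -> : \sum_c (2 * octv_dot x y 0 c) ^+ 2 = 4 * oct_normsq (octv_dot x y).
  by rewrite mulr_sumr; apply: eq_bigr => c _; ring.
rewrite -[X in _ = X + _ + _ + _]mulr_natl -[(_ + _) *+ (16 - k)]mulr_natl.
(* The subtraction 16 - k is truncated, and k <= 16 makes it the true one. *)
rewrite natrB // (_ : \sum_i \sum_j W i j =
  60 * (octv_normsq x + octv_normsq y) ^+ 2
  - 28 * ((octv_normsq x - octv_normsq y) ^+ 2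
          + 4 * oct_normsq (octv_dot x y)) - 32 * (\sum_i \sum_j P i j ^+ 2 +
    \sum_c \sum_i \sum_j Q c i j ^+ 2)); last first.
  by rewrite -sum_pair_identity addrK.
ring.
Qed.

End PairIdentity.

(** * Closure properties of sums of squares *)

Section SumsOfSquares.
Variables (R : realType) (n : nat).
Implicit Types p q : {mpoly R[n]}.

Lemma is_sos0 : is_sos (0 : {mpoly R[n]}).
Proof. by exists [::]; rewrite big_nil. Qed.

Lemma is_sos_sqr p : is_sos (p ^+ 2).
Proof. by exists [:: p]; rewrite big_seq1. Qed.

Lemma is_sosD p q : is_sos p -> is_sos q -> is_sos (p + q).
Proof. by move=> [s ->] [t ->]; exists (s ++ t); rewrite big_cat. Qed.

Lemma is_sos_sum (I : finType) (F : I -> {mpoly R[n]}) :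
  (forall i, is_sos (F i)) -> is_sos (\sum_i F i).
Proof.
by move=> sosF; elim/big_ind: _ => //; [exact: is_sos0 | exact: is_sosD].
Qed.

Lemma is_sosMn p m : is_sos p -> is_sos (p *+ m).
Proof.
move=> sosp; elim: m => [|m IHm]; first by rewrite mulr0n; exact: is_sos0.
by rewrite mulrS; exact: is_sosD.
Qed.

Lemma is_sosZ (t : R) p : 0 <= t -> is_sos p -> is_sos (t *: p).
Proof.
move=> t0 [s ->]; exists [seq Num.sqrt t *: f | f <- s].
rewrite big_map scaler_sumr; apply: eq_bigr => f _.
by rewrite exprZn sqr_sqrtr.
Qed.

Lemma is_sos_ip (X : 'M[{mpoly R[n]}]_8) : is_sos (ip X X).
Proof. by do 2!apply: is_sos_sum => ?; rewrite -expr2; exact: is_sos_sqr. Qed.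

End SumsOfSquares.

Lemma qO_form_is_sos (R : realType) k : (k <= 16)%N -> is_sos (qO_form R k).
Proof.
move=> k16; rewrite /qO_form /qO.
set X := octv_normsq _; set Y := octv_normsq _; set D := octv_dot _ _.
rewrite (_ : X * Y - oct_normsq D + 4^-1 *: (X + Y) ^+ 2 =
    960^-1 *: (960 * (X * Y - oct_normsq D) + 240 * (X + Y) ^+ 2)); last first.
  rewrite [RHS]scalerDr !mulr_natl -!scaler_nat !scalerA mulVf ?scale1r ?pnatr_eq0 //.
  by congr (_ + _ *: _); field.
apply: is_sosZ; first by rewrite invr_ge0 ler0n.
rewrite sos_identity //.
repeat first [exact: is_sos_sqr | exact: is_sos_ip | apply: is_sosD
  | apply: is_sosMn | apply: is_sos_sum => ?].
Qed.

(** * The separating functional for k >= 17 *)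

Section SecondOrder.
Variables (R : realType) (n : nat).
Implicit Types (f g p : {mpoly R[n]}) (s t u v : 'I_n).

Definition at0 p : R := p.@[fun=> 0].
Definition hess p s t : R := at0 p^`M(s)^`M(t).
Definition deriv4 p s t u v : R := at0 p^`M(s)^`M(t)^`M(u)^`M(v).
(** No constant and no linear term: the summands of a sum of squares are not assumed homogeneous,
    and this replaces being a quadratic form. *)
Definition flat p := at0 p = 0 /\ forall s, at0 p^`M(s) = 0.

Definition sym4 (F : 'I_n -> 'I_n -> R) s t u v : R :=
  F s t * F u v + F s u * F t v + F s v * F t u.

Lemma at0D p q : at0 (p + q) = at0 p + at0 q. Proof. exact: mevalD. Qed.
Lemma at0M p q : at0 (p * q) = at0 p * at0 q. Proof. exact: mevalM. Qed.
Lemma at0Z c p : at0 (c *: p) = c * at0 p. Proof. exact: mevalZ. Qed.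

Lemma hessC p s t : hess p s t = hess p t s.
Proof. by rewrite /hess mderiv_comm. Qed.

Lemma hessD p q s t : hess (p + q) s t = hess p s t + hess q s t.
Proof. by rewrite /hess !mderivD at0D. Qed.

Lemma hessM f g s t : hess (f * g) s t =
  hess f s t * at0 g + at0 f^`M(s) * at0 g^`M(t)
  + at0 f^`M(t) * at0 g^`M(s) + at0 f * hess g s t.
Proof. by rewrite /hess !(mderivM, mderivD) !(at0D, at0M) !addrA. Qed.

(** By Leibniz only terms with two derivatives on each factor survive: each of the three pairings of
    the indices occurs twice. Only the Hessian of f matters, so higher terms of f are harmless. *)
Lemma deriv4_sqr f s t u v : flat f ->
  deriv4 (f ^+ 2) s t u v = 2 * sym4 (hess f) s t u v.
Proof.
move=> [f0 df0].
have -> : deriv4 (f ^+ 2) s t u v = hess (f ^+ 2)^`M(s)^`M(t) u v by [].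
rewrite expr2 !(mderivM, mderivD) !(hessD, hessM) !df0 !f0.
rewrite !(mulr0, mul0r, addr0, add0r) /sym4 /hess.
do 6!move: (at0 (mderiv _ (mderiv _ f))) => ?; ring.
Qed.

Lemma flatD f g : flat f -> flat g -> flat (f + g).
Proof.
move=> [f0 df0] [g0 dg0]; split=> [|s]; first by rewrite at0D f0 g0 addr0.
by rewrite mderivD at0D df0 dg0 addr0.
Qed.

Lemma flatZ c f : flat f -> flat (c *: f).
Proof.
move=> [f0 df0]; split=> [|s]; first by rewrite at0Z f0 mulr0.
by rewrite mderivZ at0Z df0 mulr0.
Qed.

Lemma flatM f g : at0 f = 0 -> at0 g = 0 -> flat (f * g).
Proof.
move=> f0 g0; split=> [|s]; first by rewrite at0M f0 mul0r.
by rewrite mderivM at0D !at0M f0 g0 mul0r mulr0 addr0.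
Qed.

Lemma flat0 : flat 0.
Proof. by split=> [|s]; rewrite ?mderiv0 /at0 meval0. Qed.

Lemma flat_sum (I : finType) (F : I -> {mpoly R[n]}) :
  (forall i, flat (F i)) -> flat (\sum_i F i).
Proof. by move=> flF; elim/big_ind: _ => //; [exact: flat0 | exact: flatD]. Qed.

Lemma hessZ c p s t : hess (c *: p) s t = c * hess p s t.
Proof. by rewrite /hess !mderivZ at0Z. Qed.

Lemma hess_sum (I : Type) (r : seq I) (F : I -> {mpoly R[n]}) s t :
  hess (\sum_(i <- r) F i) s t = \sum_(i <- r) hess (F i) s t.
Proof.
elim/big_rec2: _ => [|i y p _ <-]; last by rewrite hessD.
by rewrite /hess !mderiv0 /at0 meval0.
Qed.

Lemma at0X i : at0 'X_i = 0.
Proof. by rewrite /at0 mevalXU. Qed.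

Lemma hess_mulX i j s t : hess ('X_i * 'X_j) s t =
  (s == i)%:R * (t == j)%:R + (s == j)%:R * (t == i)%:R.
Proof.
have dX l r : ('X_l : {mpoly R[n]})^`M(r) = ((r == l)%:R)%:MP.
  rewrite mderivX mnm1E eq_sym; have [->|_] := eqVneq r l; last by rewrite scale0r.
  rewrite (_ : (U_(l) - U_(l))%MM = 0%MM); first by rewrite mpolyX0 alg_mpolyC.
  by apply/mnmP => m; rewrite !mnmE subnn.
by rewrite hessM !at0X !dX /at0 !mevalC; ring.
Qed.

Lemma deriv4D p q s t u v :
  deriv4 (p + q) s t u v = deriv4 p s t u v + deriv4 q s t u v.
Proof. by rewrite /deriv4 !mderivD at0D. Qed.

Lemma deriv4Z c p s t u v : deriv4 (c *: p) s t u v = c * deriv4 p s t u v.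
Proof. by rewrite /deriv4 !mderivZ at0Z. Qed.

(** A vanishing sum of real squares has vanishing terms. This applies to the values at 0, then to
    the first derivatives, since the second derivative of g^2 along s is 2 (dg/ds)^2 where g
    vanishes. *)
Lemma sos_flat (r : seq {mpoly R[n]}) f : f \in r ->
  at0 (\sum_(g <- r) g ^+ 2) = 0 ->
  (forall s, hess (\sum_(g <- r) g ^+ 2) s s = 0) -> flat f.
Proof.
move=> fr q0 hq0.
have sum0 (G : {mpoly R[n]} -> R) g : g \in r ->
    \sum_(h <- r) G h ^+ 2 = 0 -> G g = 0.
  move=> gr /eqP; rewrite psumr_eq0 => [|h _]; last exact: sqr_ge0.
  by move=> /allP/(_ _ gr)/=; rewrite sqrf_eq0 => /eqP.
have g0 g : g \in r -> at0 g = 0.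
  move=> gr; apply: sum0 gr _; rewrite -[RHS]q0 /at0 rmorph_sum.
  by apply: eq_bigr => h _; rewrite /= rmorphXn.
split=> [|s]; first exact: g0.
apply: (sum0 (fun g => at0 g^`M(s)) f fr).
apply: (mulfI (_ : 2%:R != 0 :> R)); first by rewrite pnatr_eq0.
rewrite mulr0 -[RHS](hq0 s) hess_sum mulr_sumr; apply: eq_big_seq => g gr.
by rewrite expr2 hessM (g0 g gr); ring.
Qed.

End SecondOrder.

(** * Contractions of the structure tensor, one for each pairing of four indices *)

Section GcoefSums.
Variable A : comNzRingType.
Implicit Types X Y : 'M[A]_8.

Lemma gcoef_sum_Lmx X Y :
  \sum_(a < 8) \sum_(b < 8) \sum_(a' < 8) \sum_(b' < 8)
    gcoef A a b a' b' * (X a b * Y a' b') =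
  \sum_c ip (Lmx A c) X * ip (Lmx A c) Y.
Proof.
have ipL Z c : ip (Lmx A c) Z =
      \sum_(p : 'I_8 * 'I_8) lcoef A c p.1 p.2 * Z p.1 p.2.
  rewrite -(pair_bigA _ (fun a b : 'I_8 => lcoef A c a b * Z a b)) /=.
  by apply: eq_bigr => a _; apply: eq_bigr => b _; rewrite mxE.
under [RHS]eq_bigr do rewrite !ipL big_distrlr.
rewrite pair_bigA [RHS]exchange_big; apply: eq_bigr => p _ /=.
rewrite pair_bigA [RHS]exchange_big; apply: eq_bigr => q _ /=.
by rewrite mulr_suml; apply: eq_bigr => c _; rewrite mulrACA.
Qed.

Lemma gcoef_sum_Theta X Y :
  \sum_(a < 8) \sum_(b < 8) \sum_(a' < 8) \sum_(b' < 8)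
    gcoef A a b a' b' * (X a a' * Y b b') =
  ip X (Theta Y).
Proof.
apply: eq_bigr => a _; rewrite exchange_big; apply: eq_bigr => a' _.
rewrite mxE mulr_sumr; apply: eq_bigr => b _; rewrite mulr_sumr.
by apply: eq_bigr => b' _; rewrite mulrCA.
Qed.

(** Exchanging b and b' in [gcoef] by [gcoef_sym] reduces this pairing to that of
    [gcoef_sum_Lmx]. *)
Lemma gcoef_sum_cross X Y :
  \sum_(a < 8) \sum_(b < 8) \sum_(a' < 8) \sum_(b' < 8)
    gcoef A a b a' b' * (X a b' * Y a' b) =
  2 * ip X Y - \sum_c ip (Lmx A c) X * ip (Lmx A c) Y.
Proof.
rewrite -gcoef_sum_Lmx; set S := RHS.
have swap (H : 'I_8 -> 'I_8 -> 'I_8 -> 'I_8 -> A) :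
    \sum_a \sum_b \sum_a' \sum_b' H a b a' b' =
    \sum_a \sum_b \sum_a' \sum_b' H a b' a' b.
  apply: eq_bigr => a _; rewrite exchange_big [RHS]exchange_big.
  by apply: eq_bigr => a' _; rewrite exchange_big.
rewrite {}/S swap; apply/eqP; rewrite eq_sym subr_eq; apply/eqP.
rewrite mulr_sumr -big_split; apply: eq_bigr => a _ /=.
rewrite mulr_sumr -big_split; apply: eq_bigr => b _ /=.
transitivity (\sum_(a' < 8) \sum_(b' < 8)
    ((a == a') && (b == b'))%:R *+ 2 * (X a b * Y a' b')).
  rewrite (bigD1 a) //= (bigD1 b) //= !eqxx !big1 ?addr0 => [|a' aa'|b' bb'].
  - by rewrite mulr_natl mulr2n -mulr2n.
  - by apply: big1 => b' _; rewrite eq_sym (negbTE aa') mul0rn mul0r.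
  - by rewrite eq_sym (negbTE bb') mul0rn mul0r.
rewrite -big_split; apply: eq_bigr => a' _ /=.
rewrite -big_split; apply: eq_bigr => b' _ /=.
by rewrite -gcoef_sym mulrDl addrC.
Qed.
End GcoefSums.

(** * The functional and its nonnegativity on squares *)

Section Functional.
Variables (R : realType) (k : nat).
Local Notation n := (k * 8 + k * 8)%N.
Implicit Types (T : 'I_n -> 'I_n -> 'I_n -> 'I_n -> R) (F : 'I_n -> 'I_n -> R).

Definition ix (i : 'I_k) (a : 'I_8) : 'I_n := lshift (k * 8) (mxvec_index i a).
Definition iy (i : 'I_k) (a : 'I_8) : 'I_n := rshift (k * 8) (mxvec_index i a).

(* The contraction of a quartic tensor with the polarisation of
   5 |z|^4 + sum_i Q_i^2 + 4 sum_(m,n) <z_m, z_n>^2; it is applied to the tensor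
   of fourth derivatives. *)
Definition functional_block T i j : R :=
  6 * (\sum_a \sum_b T (ix i a) (ix i a) (ix j b) (ix j b))
  + 6 * (\sum_a \sum_b T (iy i a) (iy i a) (iy j b) (iy j b))
  + 8 * (\sum_a \sum_b T (ix i a) (ix i a) (iy j b) (iy j b))
  + 4 * (\sum_a \sum_b T (ix i a) (ix j a) (ix i b) (ix j b))
  + 4 * (\sum_a \sum_b T (iy i a) (iy j a) (iy i b) (iy j b))
  + 8 * (\sum_a \sum_b T (ix i a) (ix j a) (iy i b) (iy j b))
  + 4 * (\sum_(a < 8) \sum_(b < 8) \sum_(a' < 8) \sum_(b' < 8)
           gcoef R a b a' b' * T (ix i a) (iy i b) (ix j a') (iy j b')).

Definition functional T : R := \sum_i \sum_j functional_block T i j.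

Lemma functionalP c T T' :
  functional (fun s t u v => T s t u v + c * T' s t u v) =
  functional T + c * functional T'.
Proof.
have linear8 (U V : 'I_8 -> 'I_8 -> R) : \sum_a \sum_b (U a b + c * V a b) =
    \sum_a \sum_b U a b + c * \sum_a \sum_b V a b.
  rewrite mulr_sumr -big_split; apply: eq_bigr => a _.
  by rewrite mulr_sumr -big_split.
have linear32 (U V : 'I_8 -> 'I_8 -> 'I_8 -> 'I_8 -> R) :
    \sum_(a < 8) \sum_(b < 8) \sum_(a' < 8) \sum_(b' < 8)
      gcoef R a b a' b' * (U a b a' b' + c * V a b a' b')
    = (\sum_(a < 8) \sum_(b < 8) \sum_(a' < 8) \sum_(b' < 8)
         gcoef R a b a' b' * U a b a' b')
      + c * \sum_(a < 8) \sum_(b < 8) \sum_(a' < 8) \sum_(b' < 8)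
          gcoef R a b a' b' * V a b a' b'.
  rewrite -linear8; apply: eq_bigr => a _; apply: eq_bigr => b _.
  rewrite -linear8; apply: eq_bigr => a' _; apply: eq_bigr => b' _.
  by rewrite mulrDr mulrCA.
rewrite mulr_sumr -big_split; apply: eq_bigr => i _.
rewrite mulr_sumr -big_split; apply: eq_bigr => j _ /=.
by rewrite /functional_block linear32 !linear8; ring.
Qed.

Lemma eq_functional T T' : (forall s t u v, T s t u v = T' s t u v) ->
  functional T = functional T'.
Proof.
move=> eT; apply: eq_bigr => i _; apply: eq_bigr => j _.
rewrite /functional_block.
do !congr (_ + _); congr (_ * _);
  do ![apply: eq_bigr => ? _]; by rewrite eT.
Qed.

Lemma functional0 : functional (fun _ _ _ _ => 0) = 0.
Proof.
apply: (addIr (functional (fun _ _ _ _ => 0))); rewrite add0r -[X in _ + X]mul1r.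
by rewrite -functionalP; apply: eq_functional => *; rewrite mulr0 addr0.
Qed.

Lemma functionalZ c T :
  functional (fun s t u v => c * T s t u v) = c * functional T.
Proof.
rewrite -[RHS]add0r -functional0 -functionalP.
by apply: eq_functional => *; rewrite add0r.
Qed.

Lemma functional_sum (I : eqType) (r : seq I)
    (T : I -> 'I_n -> 'I_n -> 'I_n -> 'I_n -> R) :
  functional (fun s t u v => \sum_(l <- r) T l s t u v) =
  \sum_(l <- r) functional (T l).
Proof.
elim: r => [|l r IHr].
  by rewrite big_nil -[RHS]functional0; apply: eq_functional => *; rewrite big_nil.
rewrite big_cons -IHr -[X in _ + X]mul1r -functionalP.
by apply: eq_functional => *; rewrite big_cons mul1r.
Qed.

Definition block F (e f : 'I_8 -> 'I_n) : 'M[R]_8 :=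
  \matrix_(a, b) F (e a) (f b).

Lemma sum_sym4 F e f g h :
  \sum_a \sum_b sym4 F (e a) (f a) (g b) (h b) =
  \tr (block F e f) * \tr (block F g h)
  + ip (block F e g) (block F f h) + ip (block F e h) (block F f g).
Proof.
rewrite big_distrlr -!big_split; apply: eq_bigr => a _ /=.
by rewrite -!big_split; apply: eq_bigr => b _; rewrite !mxE.
Qed.

Lemma gcoef_sum_sym4 F e f g h : (forall s t, F s t = F t s) ->
  \sum_(a < 8) \sum_(b < 8) \sum_(a' < 8) \sum_(b' < 8)
     gcoef R a b a' b' * sym4 F (e a) (f b) (g a') (h b') =
  \sum_c ip (Lmx R c) (block F e f) * ip (Lmx R c) (block F g h)
  + ip (block F e g) (Theta (block F f h))
  + (2 * ip (block F e h) (block F g f)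
     - \sum_c ip (Lmx R c) (block F e h) * ip (Lmx R c) (block F g f)).
Proof.
move=> FC; rewrite -gcoef_sum_Lmx -gcoef_sum_Theta -gcoef_sum_cross.
do 4!(rewrite -!big_split; apply: eq_bigr => ? _ /=).
by rewrite !mxE (FC (g _) (f _)) /sym4; ring.
Qed.

Local Notation bxx F i j := (block F (ix i) (ix j)).
Local Notation bxy F i j := (block F (ix i) (iy j)).
Local Notation byy F i j := (block F (iy i) (iy j)).

(** Collects the pairings that match indices of z_i with each other and those of z_j with each
    other. The coefficients 6, 6, 8 come from 5 |z|^4 + Q_0^2, as 5 + 1, 5 + 1 and 10 - 2. *)
Definition trace_block F i j : R :=
  6 * (\tr (bxx F i i) * \tr (bxx F j j))
  + 6 * (\tr (byy F i i) * \tr (byy F j j))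
  + 8 * (\tr (bxx F i i) * \tr (byy F j j))
  + 4 * ip (bxx F i i) (bxx F j j) + 4 * ip (byy F i i) (byy F j j)
  + 8 * ip (bxy F i i) (bxy F j j)
  + 4 * \sum_c ip (Lmx R c) (bxy F i i) * ip (Lmx R c) (bxy F j j).

(** Collects the two pairings that match indices of z_i with indices of z_j. *)
Definition pair_block F i j : R :=
  12 * ip (bxx F i j) (bxx F i j) + 12 * ip (byy F i j) (byy F i j)
  + 4 * (\tr (bxx F i j) + \tr (byy F i j)) ^+ 2
  + 4 * ip (bxx F i j) (bxx F i j)^T + 4 * ip (byy F i j) (byy F i j)^T
  + 4 * ip (bxx F i j) (Theta (byy F i j))
  + (16 * ip (bxy F i j) (bxy F i j) + 16 * ip (bxy F i j) (bxy F j i)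
     - 4 * \sum_c ip (Lmx R c) (bxy F i j) * ip (Lmx R c) (bxy F j i)).

Lemma functional_sym4 F : (forall s t, F s t = F t s) ->
  functional (sym4 F) = \sum_i \sum_j (trace_block F i j + pair_block F i j).
Proof.
move=> FC; apply: eq_bigr => i _; apply: eq_bigr => j _.
rewrite /functional_block !sum_sym4 gcoef_sum_sym4 //.
have block_tr e f : block F f e = (block F e f)^T.
  by apply/matrixP => a b; rewrite !mxE FC.
rewrite (block_tr (ix i) (ix j)) (block_tr (iy i) (iy j)).
rewrite /trace_block /pair_block; ring.
Qed.

(** The trace blocks add up to a nonnegative quadratic expression in the sums of the diagonal
    blocks; the pair blocks, once symmetrised in i and j, are nonnegative one by one. *)
Lemma functional_sym4_ge0 F : (forall s t, F s t = F t s) ->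
  0 <= functional (sym4 F).
Proof.
move=> FC; rewrite functional_sym4 //.
pose trX := \sum_i \tr (bxx F i i); pose trY := \sum_i \tr (byy F i i).
pose SX := \sum_i bxx F i i; pose SY := \sum_i byy F i i.
pose SZ := \sum_i bxy F i i.
have sumD (U V : 'I_k -> 'I_k -> R) : \sum_i \sum_j U i j + \sum_i \sum_j V i j
    = \sum_i \sum_j (U i j + V i j).
  by rewrite -big_split; apply: eq_bigr => i _; rewrite big_split.
have sumZ t (U : 'I_k -> 'I_k -> R) : t * (\sum_i \sum_j U i j)
    = \sum_i \sum_j t * U i j.
  by rewrite mulr_sumr; apply: eq_bigr => i _; rewrite mulr_sumr.
have ip_suml (G : 'I_k -> 'M[R]_8) X : ip (\sum_i G i) X = \sum_i ip (G i) X.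
  by rewrite ipC ip_sumr; under eq_bigr do rewrite ipC.
have -> : \sum_i \sum_j (trace_block F i j + pair_block F i j) =
    6 * (trX * trX) + 6 * (trY * trY) + 8 * (trX * trY)
    + 4 * ip SX SX + 4 * ip SY SY + 8 * ip SZ SZ
    + 4 * (\sum_c ip (Lmx R c) SZ ^+ 2)
    + \sum_i \sum_j pair_block F i j.
  have ip_SS (G : 'I_k -> 'M[R]_8) :
      ip (\sum_i G i) (\sum_i G i) = \sum_i \sum_j ip (G i) (G j).
    by rewrite ip_suml; apply: eq_bigr => i _; rewrite ip_sumr.
  have -> : \sum_c ip (Lmx R c) SZ ^+ 2 = \sum_i \sum_j
      \sum_c ip (Lmx R c) (bxy F i i) * ip (Lmx R c) (bxy F j j).
    under [RHS]eq_bigr do rewrite exchange_big.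
    rewrite [RHS]exchange_big; apply: eq_bigr => c _.
    by rewrite expr2 ip_sumr big_distrlr.
  by rewrite !ip_SS !big_distrlr /= !sumZ !sumD.
apply: addr_ge0.
  have LZ : 0 <= \sum_c ip (Lmx R c) SZ ^+ 2.
    by apply: sumr_ge0 => c _; exact: sqr_ge0.
  have := ip_ge0 SX; have := ip_ge0 SY; have := ip_ge0 SZ.
  (* 6 s^2 + 6 t^2 + 8 s t = 4 (s + t)^2 + 2 s^2 + 2 t^2. *)
  have := sqr_ge0 (trX + trY); have := sqr_ge0 trX; have := sqr_ge0 trY.
  by rewrite sqrrD !expr2; move: LZ; lra.
(* Half of the term 16 |Z_ij|^2 is moved to the pair (j, i), which gives the shape needed for
   [ip_Lmx_ge0]. *)
pose Z2 i j := ip (bxy F i j) (bxy F i j).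
have -> : \sum_i \sum_j pair_block F i j = \sum_i \sum_j
    (pair_block F i j + - 8 * Z2 i j + 8 * Z2 j i).
  have Z2C : \sum_i \sum_j Z2 j i = \sum_i \sum_j Z2 i j by rewrite exchange_big.
  by rewrite -!sumD -!sumZ Z2C; ring.
apply: sumr_ge0 => i _; apply: sumr_ge0 => j _.
have := ip_Theta_ge0 (bxx F i j) (byy F i j).
have := ip_Lmx_ge0 (bxy F i j) (bxy F j i).
rewrite /pair_block /Z2; lra.
Qed.

(** When the Hessian acts identically on every z_i, the trace blocks are all equal, giving k^2, and
    the pair blocks vanish off the diagonal, giving k. *)
Lemma functional_diag F X Y Z : (forall s t, F s t = F t s) ->
  (forall i j, bxx F i j = (i == j)%:R *: X) ->
  (forall i j, byy F i j = (i == j)%:R *: Y) ->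
  (forall i j, bxy F i j = (i == j)%:R *: Z) ->
  functional (sym4 F) =
  k%:R ^+ 2 *
    (6 * \tr X ^+ 2 + 6 * \tr Y ^+ 2 + 8 * (\tr X * \tr Y)
     + 4 * ip X X + 4 * ip Y Y + 8 * ip Z Z + 4 * \sum_c ip (Lmx R c) Z ^+ 2)
  + k%:R *
    (12 * ip X X + 12 * ip Y Y + 4 * (\tr X + \tr Y) ^+ 2
     + 4 * ip X X^T + 4 * ip Y Y^T + 4 * ip X (Theta Y)
     + 32 * ip Z Z - 4 * \sum_c ip (Lmx R c) Z ^+ 2).
Proof.
move=> FC FX FY FZ; rewrite functional_sym4 //.
have ip0 U : ip 0 U = 0 :> R by rewrite -(scale0r 0) ipZl mul0r.
have sum_ip0 : \sum_c ip (Lmx R c) 0 * ip (Lmx R c) 0 = 0.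
  by apply: big1 => c _; rewrite ipC ip0 mul0r.
set t := (X in _ = _ * X + _); set p := (X in _ = _ + _ * X).
transitivity (\sum_(i < k) \sum_(j < k) (t + (i == j)%:R * p)).
  apply: eq_bigr => i _; apply: eq_bigr => j _.
  rewrite /trace_block /pair_block !FX !FY !FZ !eqxx !scale1r.
  rewrite (eq_sym j); have [_|_] := eqVneq i j.
    by rewrite !scale1r mul1r /t /p; ring.
  rewrite !scale0r !mxtrace0 !ip0 sum_ip0.
  by rewrite mul0r /t; ring.
under eq_bigr => i _.
  rewrite big_split sumr_const card_ord /= (bigD1 i) //= eqxx mul1r.
  rewrite big1 ?addr0 => [|j]; last by rewrite eq_sym => /negbTE ->; rewrite mul0r.
  over.
by rewrite sumr_const card_ord -[LHS]mulr_natl -[t *+ k]mulr_natl; ring.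
Qed.
End Functional.

(** * Values of the functional on the squares that make up q *)

Section Hessians.
Variables (R : realType) (k : nat).
Local Notation n := (k * 8 + k * 8)%N.
Local Notation X2 := (octv_normsq (@xvars R k)).
Local Notation Y2 := (octv_normsq (@yvars R k)).
Local Notation D c := (octv_dot (@xvars R k) (@yvars R k) 0 c).

Lemma mxvec_index_eq (i j : 'I_k) (a b : 'I_8) :
  (mxvec_index i a == mxvec_index j b) = ((i, a) == (j, b)).
Proof.
by rewrite (inj_eq (@cast_ord_inj _ _ _)) (inj_eq enum_rank_inj).
Qed.

Lemma ix_eq (i j : 'I_k) (a b : 'I_8) : (ix i a == ix j b) = ((i, a) == (j, b)).
Proof. by rewrite (inj_eq (@lshift_inj _ _)) mxvec_index_eq. Qed.

Lemma iy_eq (i j : 'I_k) (a b : 'I_8) : (iy i a == iy j b) = ((i, a) == (j, b)).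
Proof. by rewrite (inj_eq (@rshift_inj _ _)) mxvec_index_eq. Qed.

Lemma ix_iy (i j : 'I_k) (a b : 'I_8) : (ix i a == iy j b) = false.
Proof. exact: eq_lrshift. Qed.

Lemma iy_ix (i j : 'I_k) (a b : 'I_8) : (iy i a == ix j b) = false.
Proof. exact: eq_rlshift. Qed.

Lemma sum_pair_delta (i : 'I_k) (a : 'I_8) (G : 'I_k -> 'I_8 -> R) :
  \sum_j \sum_b ((i, a) == (j, b))%:R * G j b = G i a.
Proof.
rewrite (bigD1 i) //= (bigD1 a) //= eqxx mul1r.
rewrite !big1 ?addr0 // => [j ji|b ba]; last first.
  by rewrite xpair_eqE eqxx eq_sym (negbTE ba) mul0r.
by apply: big1 => b _; rewrite xpair_eqE eq_sym (negbTE ji) mul0r.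
Qed.

Lemma hess_normsq_x s t :
  hess X2 s t = 2 * \sum_i \sum_a (s == ix i a)%:R * (t == ix i a)%:R.
Proof.
rewrite hess_sum mulr_sumr; apply: eq_bigr => i _.
rewrite hess_sum mulr_sumr; apply: eq_bigr => a _.
by rewrite mxE expr2 hess_mulX; ring.
Qed.

Lemma hess_normsq_y s t :
  hess Y2 s t = 2 * \sum_i \sum_a (s == iy i a)%:R * (t == iy i a)%:R.
Proof.
rewrite hess_sum mulr_sumr; apply: eq_bigr => i _.
rewrite hess_sum mulr_sumr; apply: eq_bigr => a _.
by rewrite mxE expr2 hess_mulX; ring.
Qed.

Lemma hess_dot c s t :
  hess (D c) s t = \sum_i \sum_(a < 8) \sum_(b < 8) lcoef R c a b *
    ((s == ix i a)%:R * (t == iy i b)%:R + (s == iy i b)%:R * (t == ix i a)%:R).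
Proof.
rewrite octv_dotE hess_sum; apply: eq_bigr => i _; rewrite conj_mulE.
rewrite hess_sum; apply: eq_bigr => a _; rewrite hess_sum; apply: eq_bigr => b _.
rewrite !mxE lcoef_int mulrzl -scaler_int hessZ -lcoef_int.
by rewrite hess_mulX.
Qed.

Lemma flat_normsq_x : flat X2.
Proof.
apply: flat_sum => i; apply: flat_sum => a.
by rewrite mxE expr2; apply: flatM; exact: at0X.
Qed.

Lemma flat_normsq_y : flat Y2.
Proof.
apply: flat_sum => i; apply: flat_sum => a.
by rewrite mxE expr2; apply: flatM; exact: at0X.
Qed.

Lemma flat_dot c : flat (D c).
Proof.
rewrite octv_dotE; apply: flat_sum => i; rewrite conj_mulE.
apply: flat_sum => a; apply: flat_sum => b.
rewrite !mxE lcoef_int mulrzl -scaler_int.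
by apply: flatZ; apply: flatM; exact: at0X.
Qed.

Lemma hess_normsq (e : R) i j :
  [/\ block (hess (X2 + e *: Y2)) (ix i) (ix j) = (i == j)%:R *: 2%:M,
      block (hess (X2 + e *: Y2)) (iy i) (iy j) = (i == j)%:R *: (2 * e)%:M
    & block (hess (X2 + e *: Y2)) (ix i) (iy j) = (i == j)%:R *: 0].
Proof.
have delta (a b : 'I_8) (t : R) :
    t * ((j, b) == (i, a))%:R = (i == j)%:R * (t *+ (a == b)).
  rewrite xpair_eqE eq_sym (eq_sym b); case: (i == j) => /=.
    by rewrite mul1r mulr_natr.
  by rewrite mulr0 mul0r.
split; apply/matrixP => a b;
  rewrite !mxE hessD hessZ hess_normsq_x hess_normsq_y.
- under eq_bigr do under eq_bigr do rewrite !ix_eq.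
  under [X in e * (2 * X)]eq_bigr do under eq_bigr do rewrite ix_iy mul0r.
  rewrite sum_pair_delta big1 => [|l _]; last by rewrite big1.
  by rewrite !mulr0 addr0 delta.
- under eq_bigr do under eq_bigr do rewrite iy_ix mul0r.
  under [X in e * (2 * X)]eq_bigr do under eq_bigr do rewrite !iy_eq.
  rewrite sum_pair_delta big1 => [|l _]; last by rewrite big1.
  by rewrite mulr0 add0r mulrA (mulrC e) delta.
- under eq_bigr do under eq_bigr do rewrite (iy_ix j) mulr0.
  under [X in e * (2 * X)]eq_bigr do under eq_bigr do rewrite ix_iy mul0r.
  by rewrite !big1 ?mulr0 ?addr0 // => l _; rewrite big1.
Qed.

(** The cases e = 1 and e = -1 are |z|^2 and Q_0; in the latter the term linear in k vanishes. *)
Lemma functional_normsq (e : R) : e ^+ 2 = 1 ->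
  functional (sym4 (hess (X2 + e *: Y2))) =
  k%:R ^+ 2 * (3328 + 2048 * e) + k%:R * (3072 + 3072 * e).
Proof.
move=> e2.
have Theta_scalar t : Theta t%:M = (8 * t)%:M :> 'M[R]_8.
  have := Theta_sym ((t / 2)%:M : 'M[R]_8).
  rewrite tr_scalar_mx -raddfD /= -splitr mxtrace_scalar => ->.
  by congr (_%:M); rewrite -mulrnA -mulr_natl; field.
apply: etrans (functional_diag (X := 2%:M) (Y := (2 * e)%:M) (Z := 0) _ _ _ _) _.
- by move=> s t; rewrite hessC.
- by move=> i j; case: (hess_normsq e i j).
- by move=> i j; case: (hess_normsq e i j).
- by move=> i j; case: (hess_normsq e i j).
have ip0 U : ip U 0 = 0 :> R by rewrite -(scale0r 0) ipZr mul0r.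
rewrite !Theta_scalar !tr_scalar_mx !ip_scalar !mxtrace_scalar !ip0.
rewrite big1 => [|c _]; last by rewrite ip0 expr0n.
ring: e2.
Qed.

(** Here |L_c|^2 = 8 makes the linear coefficient 32 * 8 - 4 * 64 = 0 and the quadratic one 8 * 8 +
    4 * 64. *)
Lemma functional_dot c : functional (sym4 (hess (D c))) = 320 * k%:R ^+ 2.
Proof.
apply: etrans (functional_diag (X := 0) (Y := 0) (Z := Lmx R c) _ _ _ _) _; last first.
- have ip0 U : ip 0 U = 0 :> R by rewrite -(scale0r 0) ipZl mul0r.
  rewrite !ip0 mxtrace0 ip_Lmx eqxx (bigD1 c) //= ip_Lmx eqxx.
  rewrite big1 => [|d dc]; first by rewrite /=; ring.
  by rewrite ip_Lmx (negbTE dc) mul0rn expr0n.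
- move=> i j; apply/matrixP => a b; rewrite !mxE hess_dot.
  transitivity (\sum_l \sum_a' ((i, a) == (l, a'))%:R *
      \sum_b' ((j, b) == (l, b'))%:R * lcoef R c a' b').
    apply: eq_bigr => l _; apply: eq_bigr => a' _; rewrite mulr_sumr.
    apply: eq_bigr => b' _; rewrite ix_eq iy_eq ix_iy mul0r addr0; ring.
  rewrite sum_pair_delta (bigD1 b) //= xpair_eqE eqxx andbT eq_sym.
  rewrite big1 ?addr0 // => b' bb'.
  by rewrite xpair_eqE [b == b']eq_sym (negbTE bb') andbF mul0r.
- move=> i j; apply/matrixP => a b; rewrite scaler0 !mxE hess_dot.
  do 3!(apply: big1 => ? _); by rewrite !iy_ix mul0r mulr0 addr0 mulr0.
- move=> i j; apply/matrixP => a b; rewrite scaler0 !mxE hess_dot.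
  do 3!(apply: big1 => ? _); by rewrite !ix_iy mul0r mulr0 addr0 mulr0.
- by move=> s t; rewrite hessC.
Qed.

End Hessians.

(** * Evaluation of the functional at q *)

Lemma deriv4_sum (R : realType) n (I : Type) (r : seq I)
    (F : I -> {mpoly R[n]}) s t u v :
  deriv4 (\sum_(i <- r) F i) s t u v =
  \sum_(i <- r) deriv4 (F i) s t u v.
Proof.
elim/big_rec2: _ => [|i y p _ <-]; last by rewrite deriv4D.
by rewrite /deriv4 !mderiv0 /at0 meval0.
Qed.

Lemma qO_form_not_sos (R : realType) k : (17 <= k)%N -> ~ is_sos (qO_form R k).
Proof.
move=> k17 [r qE].
set X2 := octv_normsq (@xvars R k); set Y2 := octv_normsq (@yvars R k).
pose D c := octv_dot (@xvars R k) (@yvars R k) 0 c.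
pose P := X2 + 1 *: Y2; pose M := X2 + -1 *: Y2.
(* The product of the squared norms of x and y is (P^2 - M^2) / 4, so q is a combination of squares
   of flat forms, to which [deriv4_sqr] applies. *)
have {}qE : \sum_(f <- r) f ^+ 2 =
    2^-1 *: P ^+ 2 + (- 4^-1) *: M ^+ 2 + -1 *: \sum_c D c ^+ 2.
  rewrite -qE /qO_form /qO -/X2 -/Y2 /P /M scaleN1r scale1r.
  have -> : X2 * Y2 = 4^-1 *: ((X2 + Y2) ^+ 2 - (X2 - Y2) ^+ 2).
    rewrite (_ : _ - _ = 4%:R *: (X2 * Y2)); last by rewrite scaler_nat; ring.
    by rewrite scalerA mulVf ?scale1r ?pnatr_eq0.
  rewrite scalerBr !scaleNr scale1r.
  rewrite (_ : 2^-1 *: _ = 4^-1 *: (X2 + Y2) ^+ 2 + 4^-1 *: (X2 + Y2) ^+ 2); last first.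
    by rewrite -scalerDl; congr (_ *: _); field.
  rewrite -[\sum_c D c ^+ 2]/(oct_normsq (octv_dot (@xvars R k) (@yvars R k))).
  by move: (4^-1 *: _) (4^-1 *: _) (oct_normsq _) => a b c; ring.
have flP : flat P by apply: flatD (flat_normsq_x _ _) (flatZ _ (flat_normsq_y _ _)).
have flM : flat M by apply: flatD (flat_normsq_x _ _) (flatZ _ (flat_normsq_y _ _)).
have at0_sqr f : flat f -> at0 (f ^+ 2) = 0.
  by move=> [f0 _]; rewrite expr2 at0M f0 mul0r.
have hess_sqr f s : flat f -> hess (f ^+ 2) s s = 0.
  by move=> [f0 df0]; rewrite expr2 hessM f0 !df0; ring.
have flr f : f \in r -> flat f.
  move=> fr; apply: (sos_flat fr); rewrite qE.
    rewrite !at0D !at0Z !at0_sqr // /at0 raddf_sum big1 ?mulr0 ?addr0 // => c _.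
    exact: at0_sqr (flat_dot R k c).
  move=> s; rewrite !hessD !hessZ !hess_sqr // hess_sum big1 ?mulr0 ?addr0 // => c _.
  exact: hess_sqr (flat_dot R k c).
have : 0 <= functional (deriv4 (\sum_(f <- r) f ^+ 2)).
  rewrite (eq_functional (fun s t u v => deriv4_sum r _ s t u v)) functional_sum.
  rewrite big_seq; apply: sumr_ge0 => f fr.
  rewrite (eq_functional (fun s t u v => deriv4_sqr s t u v (flr f fr))) functionalZ.
  by rewrite mulr_ge0 ?ler0n // functional_sym4_ge0 // => s t; exact: hessC.
pose T1 s t u v := sym4 (hess P) s t u v + - 2^-1 * sym4 (hess M) s t u v.
pose T2 s t u v := \sum_c sym4 (hess (D c)) s t u v.
rewrite qE (eq_functional (T' := fun s t u v => T1 s t u v + -2 * T2 s t u v)); last first.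
  move=> s t u v; rewrite !deriv4D !deriv4Z !deriv4_sqr // deriv4_sum.
  under eq_bigr => c _ do rewrite (deriv4_sqr _ _ _ _ (flat_dot R k c)).
  by rewrite -mulr_sumr /T1 /T2; field.
rewrite (functionalP _ T1 T2) (functionalP _ (sym4 (hess P)) (sym4 (hess M))).
rewrite (functional_sum _ (fun c => sym4 (hess (D c)))).
have sqr_opp1 : (-1) ^+ 2 = 1 :> R by rewrite sqrrN expr1n.
rewrite (functional_normsq k (expr1n R 2)) (functional_normsq k sqr_opp1).
under eq_bigr do rewrite functional_dot.
rewrite sumr_const card_ord -mulr_natl.
(* The value is (5376 k^2 + 6144 k) - 1280 k^2 / 2 - 2 * 8 * 320 k^2 = - 384 k (k - 16), negative
   for k >= 17. *)
have : 17 <= k%:R :> R by rewrite ler_nat.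
move: (k%:R) => K; nra.
Qed.

Theorem theorem4p11 (R : realType) (k : nat) (hk : (1 <= k)%N) :
  ((17 <= k)%N -> ~ is_sos (qO_form R k)) /\
  ((k <= 16)%N -> is_sos (qO_form R k)).
Proof. by split; [exact: qO_form_not_sos | exact: qO_form_is_sos]. Qed.
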